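(* Let $(A,\ast,\curlyvee,\diamond,\bullet)$ be an NS-Poisson algebra. Let $(A,\odot,\{\!\!\{~,~\}\!\!\})$ be its sub-adjacent Poisson algebra, where $x\odot y=x\ast y+y\ast x+x\curlyvee y$ and $\{\!\!\{x,y\}\!\!\}=x\diamond y-y\diamond x+x\bullet y$, and let $(A,\mu,\rho)$ be the representation of $(A,\odot,\{\!\!\{~,~\}\!\!\})$ given by $\mu_xy=x\ast y$ and $\rho_xy=x\diamond y$. Define $h\in\mathrm{Hom}(A^{\otimes2},A)$ and $H\in\mathrm{Hom}(\wedge^2A,A)$ by $h(x,y)=x\curlyvee y$ and $H(x,y)=x\bullet y$, for $x,y\in A$. Then the pair $(h,H)$ is a Poisson $2$-cocycle of $(A,\odot,\{\!\!\{~,~\}\!\!\})$ with coefficients in the representation $(A,\mu,\rho)$. Moreover, the identity map $\mathrm{Id}:A\to A$ is an $(h,H)$-twisted Rota-Baxter operator on $(A,\odot,\{\!\!\{~,~\}\!\!\})$ with respect to the representation $(A,\mu,\rho)$. Further, the NS-Poisson algebra structure on $A$ induced by this twisted Rota-Baxter operator coincides with the given one $(A,\ast,\curlyvee,\diamond,\bullet)$.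
   Context: All vector spaces and (multi)linear maps are over a field $\mathbf{k}$ of characteristic $0$. Associative algebras are not required to be unital. An NS-commutative algebra is a triple $(A,\ast,\curlyvee)$ of a vector space $A$ with bilinear operations $\ast,\curlyvee$, where $\curlyvee$ is commutative, such that for all $x,y,z\in A$, with $x\odot y=x\ast y+y\ast x+x\curlyvee y$: $$x\ast(y\ast z)=(x\odot y)\ast z,\qquad x\ast(y\curlyvee z)+x\curlyvee(y\odot z)=y\ast(x\curlyvee z)+y\curlyvee(x\odot z).$$ An NS-Lie algebra is a triple $(A,\diamond,\bullet)$ of a vector space $A$ with bilinear operations $\diamond,\bullet$, where $\bullet$ is skew-symmetric, such that for all $x,y,z\in A$, with $\{\!\!\{x,y\}\!\!\}=x\diamond y-y\diamond x+x\bullet y$: $$x\diamond(y\diamond z)-(x\diamond y)\diamond z-y\diamond(x\diamond z)+(y\diamond x)\diamond z=(x\bullet y)\diamond z,$$ $$x\bullet\{\!\!\{y,z\}\!\!\}+y\bullet\{\!\!\{z,x\}\!\!\}+z\bullet\{\!\!\{x,y\}\!\!\}+x\diamond(y\bullet z)+y\diamond(z\bullet x)+z\diamond(x\bullet y)=0.$$ An NS-Poisson algebra is a quintuple $(A,\ast,\curlyvee,\diamond,\bullet)$ such that $(A,\ast,\curlyvee)$ is an NS-commutative algebra, $(A,\diamond,\bullet)$ is an NS-Lie algebra, and for all $x,y,z\in A$, with $x\odot y=x\ast y+y\ast x+x\curlyvee y$ and $\{\!\!\{x,y\}\!\!\}=x\diamond y-y\diamond x+x\bullet y$: $$\{\!\!\{x,y\}\!\!\}\ast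 z=x\diamond(y\ast z)-y\ast(x\diamond z),$$ $$(x\odot y)\diamond z=x\ast(y\diamond z)+y\ast(x\diamond z),$$ $$x\bullet(y\odot z)+x\diamond(y\curlyvee z)=\{\!\!\{x,y\}\!\!\}\curlyvee z+z\ast(x\bullet y)+y\curlyvee\{\!\!\{x,z\}\!\!\}+y\ast(x\bullet z).$$ For such an algebra, $(A,\odot,\{\!\!\{~,~\}\!\!\})$ is a Poisson algebra (the sub-adjacent Poisson algebra) and $(A,\mu,\rho)$ with $\mu_xy=x\ast y$, $\rho_xy=x\diamond y$ is a representation of it. A Poisson algebra is a triple $(A,\cdot,\{~,~\})$ with $(A,\cdot)$ a commutative associative algebra and $\{~,~\}$ a Lie bracket on $A$ satisfying $\{x,y\cdot z\}=\{x,y\}\cdot z+y\cdot\{x,z\}$. A representation of it is a triple $(V,\mu,\rho)$ where $\mu:A\to\mathrm{End}(V)$ is linear with $\mu_{x\cdot y}=\mu_x\circ\mu_y$, $(V,\rho)$ is a representation of the Lie algebra $(A,\{~,~\})$, and $\rho_x\circ\mu_y-\mu_y\circ\rho_x-\mu_{\{x,y\}}=0$, $\mu_x\circ\rho_y+\mu_y\circ\rho_x-\rho_{x\cdot y}=0$ for all $x,y\in A$. A Poisson $2$-cocycle of $(A,\cdot,\{~,~\})$ with coefficients in $(V,\mu,\rho)$ is a pair $(h,H)$ with $h\in\mathrm{Hom}(A^{\otimes 2},V)$ and $H\in\mathrm{Hom}(\wedge^2A,V)$ such that for all $x,y,z\in A$: $$h(x,y)=h(y,x),\qquad \mu_xh(y,z)+h(x,y\cdot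 z)=\mu_yh(x,z)+h(y,x\cdot z),$$ $$\rho_xH(y,z)+\rho_yH(z,x)+\rho_zH(x,y)+H(x,\{y,z\})+H(y,\{z,x\})+H(z,\{x,y\})=0,$$ $$H(x,y\cdot z)+\rho_xh(y,z)=h(\{x,y\},z)+\mu_zH(x,y)+h(y,\{x,z\})+\mu_yH(x,z).$$ A linear map $R:V\to A$ is an $(h,H)$-twisted Rota-Baxter operator with respect to $V$ if for all $u,v\in V$: $$R(u)\cdot R(v)=R\big(\mu_{R(u)}v+\mu_{R(v)}u+h(R(u),R(v))\big),\qquad \{R(u),R(v)\}=R\big(\rho_{R(u)}v-\rho_{R(v)}u+H(R(u),R(v))\big).$$ The NS-Poisson algebra structure on $V$ induced by such an $R$ is given by $u\ast' v=\mu_{R(u)}v$, $u\curlyvee' v=h(R(u),R(v))$, $u\diamond' v=\rho_{R(u)}v$, $u\bullet' v=H(R(u),R(v))$. *)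

(* Defs.v *)
From HB Require Import structures.
From mathcomp Require Import all_boot all_order all_algebra.
Set Implicit Arguments. Unset Strict Implicit. Unset Printing Implicit Defensive.
Import GRing.Theory.
Local Open Scope ring_scope.

(* A linear map [A -> End(V)] is encoded by the bilinear map [A -> V -> V]
   obtained by uncurrying, an element of [Hom(A (x) A, V)] by a bilinear map,
   and an element of [Hom(/\^2 A, V)] by a bilinear map vanishing on the
   diagonal. *)
Definition is_bilinear (K : fieldType) (U U' V : lmodType K)
    (f : U -> U' -> V) : Prop :=
  (forall u', linear (f^~ u')) /\ (forall u, linear (f u)).

Definition is_alternating (K : fieldType) (U V : lmodType K)
    (f : U -> U -> V) : Prop :=
  is_bilinear f /\ forall x, f x x = 0.

Section NSAlgebras.
Variables (K : fieldType) (A : lmodType K).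
Implicit Types ast vee dia bul : A -> A -> A.

Definition ns_odot ast vee (x y : A) : A := ast x y + ast y x + vee x y.

Definition ns_bracket dia bul (x y : A) : A := dia x y - dia y x + bul x y.

Record is_ns_commutative ast vee : Prop := IsNSCommutative {
  nsc_ast_bilinear : is_bilinear ast;
  nsc_vee_bilinear : is_bilinear vee;
  nsc_veeC : forall x y, vee x y = vee y x;
  nsc_astA : forall x y z, ast x (ast y z) = ast (ns_odot ast vee x y) z;
  nsc_vee_odot : forall x y z,
    ast x (vee y z) + vee x (ns_odot ast vee y z) =
    ast y (vee x z) + vee y (ns_odot ast vee x z)
}.

Record is_ns_lie dia bul : Prop := IsNSLie {
  nsl_dia_bilinear : is_bilinear dia;
  nsl_bul_bilinear : is_bilinear bul;
  nsl_bul_skew : forall x y, bul x y = - bul y x;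
  nsl_dia : forall x y z,
    dia x (dia y z) - dia (dia x y) z - dia y (dia x z) + dia (dia y x) z =
    dia (bul x y) z;
  nsl_bul : forall x y z,
    bul x (ns_bracket dia bul y z) + bul y (ns_bracket dia bul z x) +
    bul z (ns_bracket dia bul x y) +
    dia x (bul y z) + dia y (bul z x) + dia z (bul x y) = 0
}.

Record is_ns_poisson ast vee dia bul : Prop := IsNSPoisson {
  nsp_commutative : is_ns_commutative ast vee;
  nsp_lie : is_ns_lie dia bul;
  nsp_bracket_ast : forall x y z,
    ast (ns_bracket dia bul x y) z = dia x (ast y z) - ast y (dia x z);
  nsp_odot_dia : forall x y z,
    dia (ns_odot ast vee x y) z = ast x (dia y z) + ast y (dia x z);
  nsp_compat : forall x y z,
    bul x (ns_odot ast vee y z) + dia x (vee y z) =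
    vee (ns_bracket dia bul x y) z + ast z (bul x y) +
    vee y (ns_bracket dia bul x z) + ast y (bul x z)
}.

End NSAlgebras.

Section Poisson.
Variables (K : fieldType) (A V : lmodType K).
Implicit Types (mul br : A -> A -> A) (mu rho : A -> V -> V).
Implicit Types (h H : A -> A -> V) (R : {linear V -> A}).

Record is_comm_assoc_algebra mul : Prop := IsCommAssocAlgebra {
  caa_bilinear : is_bilinear mul;
  caa_mulC : forall x y, mul x y = mul y x;
  caa_mulA : forall x y z, mul (mul x y) z = mul x (mul y z)
}.

Record is_lie_algebra br : Prop := IsLieAlgebra {
  lie_alternating : is_alternating br;
  lie_jacobi : forall x y z,
    br x (br y z) + br y (br z x) + br z (br x y) = 0
}.

Record is_poisson_algebra mul br : Prop := IsPoissonAlgebra {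
  poisson_mul : is_comm_assoc_algebra mul;
  poisson_lie : is_lie_algebra br;
  poisson_leibniz : forall x y z,
    br x (mul y z) = mul (br x y) z + mul y (br x z)
}.

Record is_lie_representation br rho : Prop := IsLieRepresentation {
  lrep_bilinear : is_bilinear rho;
  lrep_bracket : forall x y v,
    rho (br x y) v = rho x (rho y v) - rho y (rho x v)
}.

(* The predicates below include that of the structure they refer to: a
   representation is one of a Poisson algebra, a cocycle has coefficients in a
   representation, and an operator is twisted by a cocycle. *)
Record is_poisson_representation mul br mu rho : Prop :=
  IsPoissonRepresentation {
  prep_poisson : is_poisson_algebra mul br;
  prep_mu_bilinear : is_bilinear mu;
  prep_mul : forall x y v, mu (mul x y) v = mu x (mu y v);
  prep_lie : is_lie_representation br rho;
  prep_rho_mu : forall x y v,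
    rho x (mu y v) - mu y (rho x v) - mu (br x y) v = 0;
  prep_mu_rho : forall x y v,
    mu x (rho y v) + mu y (rho x v) - rho (mul x y) v = 0
}.

Record is_poisson_2cocycle mul br mu rho h H : Prop := IsPoisson2Cocycle {
  coc_representation : is_poisson_representation mul br mu rho;
  coc_h_bilinear : is_bilinear h;
  coc_H_alternating : is_alternating H;
  coc_hC : forall x y, h x y = h y x;
  coc_h : forall x y z,
    mu x (h y z) + h x (mul y z) = mu y (h x z) + h y (mul x z);
  coc_H : forall x y z,
    rho x (H y z) + rho y (H z x) + rho z (H x y) +
    H x (br y z) + H y (br z x) + H z (br x y) = 0;
  coc_hH : forall x y z,
    H x (mul y z) + rho x (h y z) =
    h (br x y) z + mu z (H x y) + h y (br x z) + mu y (H x z)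
}.

Record is_twisted_rota_baxter mul br mu rho h H R : Prop :=
  IsTwistedRotaBaxter {
  trb_cocycle : is_poisson_2cocycle mul br mu rho h H;
  trb_mul : forall u v,
    mul (R u) (R v) = R (mu (R u) v + mu (R v) u + h (R u) (R v));
  trb_br : forall u v,
    br (R u) (R v) = R (rho (R u) v - rho (R v) u + H (R u) (R v))
}.

(* The operations [( *', \curlyvee', \diamond', \bullet')] on [V], in the order
   of [is_ns_poisson]. *)
Definition induced_ns_operations mu rho h H R :
    (V -> V -> V) * (V -> V -> V) * (V -> V -> V) * (V -> V -> V) :=
  (fun u v => mu (R u) v, fun u v => h (R u) (R v),
   fun u v => rho (R u) v, fun u v => H (R u) (R v)).

End Poisson.

(* Main.v *)
Require Import Defs.
From HB Require Import structures.
From mathcomp Require Import all_boot all_order all_algebra.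
Import GRing.Theory.
Local Open Scope ring_scope.
Set Implicit Arguments.
Unset Strict Implicit.
Unset Printing Implicit Defensive.

(** An NS-Poisson algebra is a Poisson algebra whose product and bracket are
cut into pieces: in [x * y + y * x + x \/ y] the first two terms are the
action [mu] of either argument on the other and the third is the cochain [h],
and likewise [x <> y - y <> x + x . y] is built from [rho] and [H].  With this
reading, the cocycle identities and the twisted Rota-Baxter identities for
[Id] are, up to the order of terms, NS-axioms or definitions, and the induced
operations are the given ones.

What has to be computed is that [odot] and [bracket] form a Poisson algebra
represented on [A].  The representation identities come first: they are the
NS-axioms [nsc_astA], [nsp_bracket_ast], [nsp_odot_dia], and [nsl_dia] after
its terms are collected ([dia_bracket]).  They turn the action of a product or
a bracket, such as [(y odot z) * x] or [{y, z} <> x], into iterated actions.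
Then in associativity, the Jacobi identity and the Leibniz rule ([ns_odotA],
[ns_jacobi], [ns_leibniz]) the iterated actions cancel, and the terms that
remain form the corresponding cocycle identity.

Characteristic zero enters when skew-symmetry of [bul] is turned into
[bul x x = 0]. *)

(** Proves an identity between signed sums in an abelian group: everything is
moved to the left, and the leading term is repeatedly cancelled by bringing its
opposite next to it.  The opposite is recognized by unification because the
sums in the goal may reach the group structure along different paths. *)
Ltac abelian_group :=
  let rec cancel t' :=
    match goal with
    | |- _ + ?s = 0 => unify s t'; first [exact: addrN | exact: addNr]
    | |- _ + (?s + _) = 0 => unify s t'; first [rewrite addNKr | rewrite addKr]
    | |- _ + ?r = 0 =>
        match r with
        | context [?a + (?s + ?b)] =>
            unify s t'; rewrite (addrCA a s b); cancel t'
        | context [?a + ?s] => unify s t'; rewrite (addrC a s); cancel t'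
        end
    end in
  apply/eqP; rewrite -subr_eq0; apply/eqP;
  rewrite ?(opprD, opprK, oppr0, addr0, add0r) -?addrA;
  repeat match goal with
  | |- - ?t + _ = 0 => cancel t
  | |- ?t + _ = 0 => cancel constr:(- t)
  end.

(** * Bilinear maps *)

Section Bilinear.
Variables (K : fieldType) (U U' V : lmodType K).
Implicit Types f g : U -> U' -> V.

Lemma bilinearDl f : is_bilinear f ->
  forall x x' y, f (x + x') y = f x y + f x' y.
Proof. by case=> lf _ x x' y; have := lf y 1 x x'; rewrite /= !scale1r. Qed.

Lemma bilinearDr f : is_bilinear f ->
  forall x y y', f x (y + y') = f x y + f x y'.
Proof. by case=> _ lf x y y'; have := lf x 1 y y'; rewrite /= !scale1r. Qed.

Lemma bilinearBl f : is_bilinear f ->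
  forall x x' y, f (x - x') y = f x y - f x' y.
Proof.
by move=> bf x x' y; apply/esym/eqP; rewrite subr_eq -bilinearDl // subrK.
Qed.

Lemma bilinearBr f : is_bilinear f ->
  forall x y y', f x (y - y') = f x y - f x y'.
Proof.
by move=> bf x y y'; apply/esym/eqP; rewrite subr_eq -bilinearDr // subrK.
Qed.

Lemma bilinear_add f g : is_bilinear f -> is_bilinear g ->
  is_bilinear (fun x y => f x y + g x y).
Proof.
move=> [fl fr] [gl gr]; split=> [y a x x'|x a y y'] /=.
  by rewrite fl gl scalerDr addrACA.
by rewrite fr gr scalerDr addrACA.
Qed.

Lemma bilinear_opp f : is_bilinear f -> is_bilinear (fun x y => - f x y).
Proof.
move=> [fl fr]; split=> [y a x x'|x a y y'] /=.
  by rewrite fl opprD scalerN.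
by rewrite fr opprD scalerN.
Qed.

Lemma bilinear_flip f : is_bilinear f -> is_bilinear (fun y x => f x y).
Proof. by case=> fl fr; split. Qed.

End Bilinear.

Lemma skew_alternating (K : fieldType) (U V : lmodType K) (f : U -> U -> V) :
  [pchar K] =i pred0 -> is_bilinear f -> (forall x y, f x y = - f y x) ->
  is_alternating f.
Proof.
move=> charK bf fC; split=> // x.
have two_neq0 : 2%:R != 0 :> K.
  by apply/negP => two0; have := charK 2; rewrite !inE two0.
have : 2%:R *: f x x = 0 by rewrite scaler_nat mulr2n {1}fC addNr.
by move/eqP; rewrite scaler_eq0 (negPf two_neq0) => /eqP.
Qed.

(** * The commutative part *)

Section NSCommutative.
Variables (K : fieldType) (A : lmodType K) (ast vee : A -> A -> A).
Hypothesis nsc : is_ns_commutative ast vee.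
Local Notation odot := (ns_odot ast vee).

Lemma ns_odotC x y : odot x y = odot y x.
Proof. by rewrite /ns_odot (nsc_veeC nsc) (addrC (ast x y)). Qed.

Lemma ns_odot_bilinear : is_bilinear odot.
Proof.
have bast := nsc_ast_bilinear nsc.
apply: bilinear_add (nsc_vee_bilinear nsc).
exact: bilinear_add bast (bilinear_flip bast).
Qed.

Lemma ns_ast_odot x y z :
  ast x (odot y z) = ast x (ast y z) + ast x (ast z y) + ast x (vee y z).
Proof. by rewrite !(bilinearDr (nsc_ast_bilinear nsc)). Qed.

Lemma ns_astCA x y z : ast x (ast y z) = ast y (ast x z).
Proof. by rewrite !(nsc_astA nsc) ns_odotC. Qed.

(** For a commutative product, associativity amounts to the symmetry of
[x odot (y odot z)] in [x] and [y].  Its part in [vee] is the cocycle identity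
of [vee], and its other terms are symmetric because the operators [ast x] and
[ast y] commute. *)
Lemma ns_odotCA x y z : odot x (odot y z) = odot y (odot x z).
Proof.
have coc := nsc_vee_odot nsc x y z.
have expand u v : odot u (odot v z) =
    ast u (ast v z) + ast u (ast z v) + ast v (ast z u)
    + (ast u (vee v z) + vee u (odot v z)).
  by rewrite {1}/ns_odot ns_ast_odot -(nsc_astA nsc); abelian_group.
by rewrite !expand coc (ns_astCA x y) (addrAC (ast y (ast x z))).
Qed.

Lemma ns_odotA x y z : odot (odot x y) z = odot x (odot y z).
Proof. by rewrite ns_odotC ns_odotCA (ns_odotC z). Qed.

Lemma ns_comm_assoc_algebra : is_comm_assoc_algebra odot.
Proof. by split; [exact: ns_odot_bilinear|exact: ns_odotC|exact: ns_odotA]. Qed.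

End NSCommutative.

(** * The Lie part *)

Section NSLie.
Variables (K : fieldType) (A : lmodType K) (dia bul : A -> A -> A).
Hypothesis nsl : is_ns_lie dia bul.
Local Notation bracket := (ns_bracket dia bul).

Lemma ns_bracket_bilinear : is_bilinear bracket.
Proof.
have bdia := nsl_dia_bilinear nsl.
apply: bilinear_add (nsl_bul_bilinear nsl).
exact: bilinear_add bdia (bilinear_opp (bilinear_flip bdia)).
Qed.

Lemma dia_bracket x y z :
  dia (bracket x y) z = dia x (dia y z) - dia y (dia x z).
Proof.
have bdia := nsl_dia_bilinear nsl.
rewrite (bilinearDl bdia) (bilinearBl bdia) -(nsl_dia nsl).
by abelian_group.
Qed.

Lemma ns_lie_representation : is_lie_representation bracket dia.
Proof. by split; [exact: nsl_dia_bilinear nsl|exact: dia_bracket]. Qed.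

(** Since [dia] is an action of the bracket, a summand [{x, {y, z}}] consists
of iterated [dia]'s, which cancel in the cyclic sum, and of terms whose cyclic
sum is the cocycle identity of [bul]. *)
Lemma ns_jacobi x y z :
  bracket x (bracket y z) + bracket y (bracket z x) + bracket z (bracket x y)
  = 0.
Proof.
have bdia := nsl_dia_bilinear nsl.
have expand u v w : bracket u (bracket v w) =
    dia u (dia v w) - dia u (dia w v) + dia u (bul v w)
    - (dia v (dia w u) - dia w (dia v u)) + bul u (bracket v w).
  rewrite {1}/ns_bracket dia_bracket.
  by rewrite (bilinearDr bdia) (bilinearBr bdia).
rewrite !expand -(nsl_bul nsl x y z).
by abelian_group.
Qed.

Lemma ns_lie_algebra : is_alternating bul -> is_lie_algebra bracket.
Proof.
move=> [_ bulxx]; split; last exact: ns_jacobi.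
split; first exact: ns_bracket_bilinear.
by move=> x; rewrite /ns_bracket bulxx subrr addr0.
Qed.

End NSLie.

(** * The sub-adjacent Poisson algebra and its representation *)

Section NSPoisson.
Variables (K : fieldType) (A : lmodType K) (ast vee dia bul : A -> A -> A).
Hypothesis nsp : is_ns_poisson ast vee dia bul.
Local Notation odot := (ns_odot ast vee).
Local Notation bracket := (ns_bracket dia bul).
Let nsc := nsp_commutative nsp.
Let nsl := nsp_lie nsp.

(** Once the mixed representation identities remove all actions of products
and brackets, the terms that do not cancel are those of [nsp_compat]. *)
Lemma ns_leibniz x y z :
  bracket x (odot y z) = odot (bracket x y) z + odot y (bracket x z).
Proof.
have bast := nsc_ast_bilinear nsc; have bdia := nsl_dia_bilinear nsl.
have -> : bracket x (odot y z) =
    dia x (ast y z) + dia x (ast z y) - (ast y (dia z x) + ast z (dia y x))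
    + (bul x (odot y z) + dia x (vee y z)).
  rewrite {1}/ns_bracket (nsp_odot_dia nsp) !(bilinearDr bdia).
  by abelian_group.
rewrite (nsp_compat nsp) /ns_odot !(nsp_bracket_ast nsp).
(* The pattern selects the brackets on the right of [ast]; those inside [vee]
   have to stay folded, as in [nsp_compat]. *)
rewrite !(bilinearDr bast _ (dia _ _ - _)) !(bilinearBr bast).
by abelian_group.
Qed.

Lemma ns_poisson_representation : is_alternating bul ->
  is_poisson_representation odot bracket ast dia.
Proof.
move=> bul_alt; split.
- split; [exact: ns_comm_assoc_algebra nsc| |exact: ns_leibniz].
  exact: ns_lie_algebra nsl bul_alt.
- exact: nsc_ast_bilinear nsc.
- by move=> x y z; rewrite (nsc_astA nsc).
- exact: ns_lie_representation nsl.
- by move=> x y z; rewrite (nsp_bracket_ast nsp) subrr.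
- by move=> x y z; rewrite (nsp_odot_dia nsp) subrr.
Qed.

Lemma ns_poisson_2cocycle : is_alternating bul ->
  is_poisson_2cocycle odot bracket ast dia vee bul.
Proof.
move=> bul_alt; split=> //.
- exact: ns_poisson_representation bul_alt.
- exact: nsc_vee_bilinear nsc.
- exact: nsc_veeC nsc.
- exact: nsc_vee_odot nsc.
- by move=> x y z; rewrite -(nsl_bul nsl x y z); abelian_group.
- exact: nsp_compat nsp.
Qed.

End NSPoisson.

Theorem proposition3p12 (K : fieldType) (charK : [pchar K] =i pred0)
    (A : lmodType K) (ast vee dia bul : A -> A -> A)
    (nsA : is_ns_poisson ast vee dia bul) :
  let odot := ns_odot ast vee in
  let bracket := ns_bracket dia bul in
  let mu := fun x y : A => ast x y in
  let rho := fun x y : A => dia x y in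
  let h := fun x y : A => vee x y in
  let H := fun x y : A => bul x y in
  let Id : {linear A -> A} := idfun in
  [/\ is_poisson_2cocycle odot bracket mu rho h H,
      is_twisted_rota_baxter odot bracket mu rho h H Id
    & induced_ns_operations mu rho h H Id = (ast, vee, dia, bul)].
Proof.
move=> odot bracket mu rho h H Id.
have nsl := nsp_lie nsA.
have bul_alt : is_alternating bul.
  exact: skew_alternating charK (nsl_bul_bilinear nsl) (nsl_bul_skew nsl).
have coc := ns_poisson_2cocycle nsA bul_alt.
by split.
Qed.
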